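(* Let $\mathbb{K}$ be a field, $X$ a non-empty set, $R\subseteq \mathbb{K}\langle X\rangle$, $A=\mathbb{K}\langle X\rangle/I(R)$ an algebra augmented by $\varepsilon: A\to\mathbb{K}$, and $\prec$ a monomial order on $\langle X\rangle$. Let $V_M$ be the set of obstructions of the set $M$ of normal words. For $n\ge -1$ let $\hat{C}_n$ be the set of $n$-chains in the top-down sense, and for $n\geq 0$ let $C_n$ be the set of $n$-chains in the bottom-up sense. Then $$\forall n\in\mathbb{N}=\{0,1,2,\dots\},\qquad \hat{C}_{n-1}=C_n.$$
   Context: $\langle X\rangle$ is the free monoid on $X$ (words, with empty word $1$), and $\mathbb{K}\langle X\rangle$ is the free associative unitary $\mathbb{K}$-algebra on $X$. $I(R)$ is the two-sided ideal generated by $R$, and $\overline{g}$ is the image of $g$ in $A$. The augmentation $\varepsilon:A\to\mathbb{K}$ is a surjective homomorphism of $\mathbb{K}$-algebras. A monomial order $\prec$ is a (total) well-order on $\langle X\rangle$ such that $u\prec v$ implies $wuw'\prec wvw'$ for all words $w,w'$. A word $u$ is a subword of $w$ if $w=aub$ for some words $a,b$ (contiguous factor). Normal words: $$M=\Big\{w\in\langle X\rangle : \text{for all } n \text{ and all } w_1,\dots,w_n\in\langle X\rangle \text{ with every } w_i\prec w, \text{ and all } \lambda_1,\dots,\lambda_n\in\mathbb{K},\ \overline{w}\neq\sum_{i=1}^n\lambda_i\overline{w_i}\Big\}.$$ Obstructions: $V_M$ is the set of those $y\in\langle X\rangle\setminus M$ such that no proper subword of $y$ lies in $\langle X\rangle\setminus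 M$. In particular, no obstruction is a proper subword of another. Top-down chains. Let $n\ge1$ and let $w=x_1\cdots x_\ell$ be a word, $x_i\in X$. The word $w$ is an $n$-prechain if there exist $n$-tuples of integers $(a_1,\dots,a_n)$ and $(b_1,\dots,b_n)$ with $$1=a_1<a_2\le b_1<a_3\le b_2<a_4\le b_3<\cdots<a_n\le b_{n-1}<b_n=\ell$$ (for $n=1$: $a_1=1$, $b_1=\ell$) and $x_{a_i}x_{a_i+1}\cdots x_{b_i}\in V_M$ for all $i\in\{1,\dots,n\}$. An $n$-prechain $w$ (with such tuples) is an $n$-chain if moreover for all $m\in\{1,\dots,n\}$ and all $i\in\{1,\dots,b_m-1\}$, the word $x_1x_2\cdots x_i$ is not an $m$-prechain. $\hat{C}_n$ is the set of these $n$-chains for $n\geq 1$; by convention $\hat{C}_{-1}=\{1\}$ and $\hat{C}_0=X$. Bottom-up chains. Let $Q$ be the directed graph with node set $$Q_0=\{1\}\cup X\cup\{s\in\langle X\rangle : s\text{ is a proper suffix of an obstruction}\}$$ and edge set $$Q_1=\{(1,x): x\in X\}\cup\{(s,t)\in(Q_0\setminus\{1\})^2 : st\text{ contains only one obstruction and it is a suffix of } st\},$$ where ''contains only one obstruction'' means that exactly one occurrence of an element of $V_M$ as a subword appears in $st$ (occurrences at different positions count separately). For $n\ge 0$, $$C_n=\Big\{\prod_{i=0}^n w_i : (1=w_0,w_1,\dots,w_n)\text{ are the successive nodes of a path of length } n \text{ in } Q \text{ starting at } 1\Big\},$$ the product being concatenation of words.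
   Formalization: The formal theorem additionally assumes that every letter of X is a normal word; without this the claim fails, since a non-normal letter is an obstruction lying in Ĉ_1 but not in C_2, whose words have length at least 2 (e.g. X = R = {x}). *)

(* Defs.v *)
From HB Require Import structures.
From mathcomp Require Import all_boot all_order all_algebra.
From mathcomp Require Import boolp classical_sets.
From mathcomp.multinomials Require Import monalg.

Set Implicit Arguments.
Unset Strict Implicit.
Unset Printing Implicit Defensive.

Import GRing.Theory.
Local Open Scope ring_scope.
Local Open Scope classical_set_scope.

(* The free monoid on X is [seq X], with unit [::] and product ++; [{fmonom X}]
   is the library's wrapper of [seq X] carrying the monoid structure on which
   monoid algebras are built. *)
Notation word X := (seq X).

Notation freeAlg K X := {malg K[{fmonom X}]}.

Record two_sided_ideal (T : pzRingType) (J : set T) : Prop := TwoSidedIdeal {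
  ideal_0 : J 0;
  ideal_add : forall f g, J f -> J g -> J (f + g);
  ideal_mull : forall h f, J f -> J (h * f);
  ideal_mulr : forall h f, J f -> J (f * h)
}.

Definition gen_ideal (T : pzRingType) (R : set T) : set T :=
  [set f | forall J : set T, two_sided_ideal J -> R `<=` J -> J f].

Lemma gen_ideal_two_sided (T : pzRingType) (R : set T) :
  two_sided_ideal (gen_ideal R).
Proof.
split=> [J hJ _|f g hf hg J hJ sRJ|h f hf J hJ sRJ|h f hf J hJ sRJ].
- exact: ideal_0 hJ.
- by apply: (ideal_add hJ); [apply: hf | apply: hg].
- by apply: (ideal_mull hJ); apply: hf.
- by apply: (ideal_mulr hJ); apply: hf.
Qed.

Definition gen_ideal_pred (T : pzRingType) (R : set T) : {pred T} :=
  fun f => `[< gen_ideal R f >].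

Lemma gen_ideal_zmod_closed (T : pzRingType) (R : set T) :
  zmod_closed (gen_ideal_pred R).
Proof.
have hI := gen_ideal_two_sided R.
split=> [|f g /asboolP hf /asboolP hg]; apply/asboolP; first exact: ideal_0 hI.
by apply: (ideal_add hI) hf _; rewrite -mulN1r; apply: (ideal_mull hI).
Qed.

HB.instance Definition _ (T : pzRingType) (R : set T) :=
  GRing.isZmodClosed.Build T (gen_ideal_pred R) (gen_ideal_zmod_closed R).

(* The algebra K<X>/I(R), as the library's quotient of an additive group by a
   subgroup (f and g are identified when f - g is in I(R)), equipped below with
   the quotient product and scaling.  It may be the zero ring, hence only
   [pzRingType] and [lmodType K] instances. *)
Definition presAlg (K : fieldType) (X : choiceType) (R : set (freeAlg K X)) :=
  Quotient.quot (gen_ideal_pred R).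

Section PresAlg.
Variables (K : fieldType) (X : choiceType) (R : set (freeAlg K X)).
Local Notation A := (presAlg R).
Local Notation pi := (\pi_A%qT : freeAlg K X -> A).

HB.instance Definition _ := GRing.Zmodule.on A.
HB.instance Definition _ := Quotient.on A.

Definition pres_class (f : freeAlg K X) : A := pi f.

Lemma pres_classP f g : gen_ideal R (f - g) <-> pres_class f = pres_class g.
Proof.
split=> [h|/eqP]; last by rewrite /pres_class -Quotient.idealrBE => /asboolP.
by apply/eqP; rewrite /pres_class -Quotient.idealrBE; apply/asboolP.
Qed.

Lemma pres_classK a : pres_class (repr a) = a.
Proof. exact: reprK. Qed.

Lemma pres_class_is_zmod_morphism : zmod_morphism pres_class.
Proof. by move=> f g; rewrite /pres_class !piE. Qed.

HB.instance Definition _ :=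
  GRing.isZmodMorphism.Build (freeAlg K X) A pres_class
    pres_class_is_zmod_morphism.

Definition pres_mul (a b : A) : A := pres_class (repr a * repr b).
Definition pres_scale (c : K) (a : A) : A := pres_class (c *: repr a).

Lemma pres_mulE f g :
  pres_mul (pres_class f) (pres_class g) = pres_class (f * g).
Proof.
have hI := gen_ideal_two_sided R; apply/pres_classP.
set f' := repr _; set g' := repr _.
have -> : f' * g' - f * g = (f' - f) * g' + f * (g' - g).
  by rewrite mulrBl mulrBr addrA subrK.
apply: (ideal_add hI); [apply: (ideal_mulr hI)|apply: (ideal_mull hI)].
  by apply/pres_classP; rewrite pres_classK.
by apply/pres_classP; rewrite pres_classK.
Qed.

Lemma pres_scaleE c f : pres_scale c (pres_class f) = pres_class (c *: f).
Proof.
have hI := gen_ideal_two_sided R; apply/pres_classP.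
rewrite -scalerBr -[_ - f]mul1r scalerAl; apply: (ideal_mull hI).
by apply/pres_classP; rewrite pres_classK.
Qed.

Lemma pres_mulA : associative pres_mul.
Proof.
move=> a b c; rewrite -(pres_classK a) -(pres_classK b) -(pres_classK c).
by rewrite !pres_mulE mulrA.
Qed.

Lemma pres_mul1r : left_id (pres_class 1) pres_mul.
Proof. by move=> a; rewrite -(pres_classK a) pres_mulE mul1r. Qed.

Lemma pres_mulr1 : right_id (pres_class 1) pres_mul.
Proof. by move=> a; rewrite -(pres_classK a) pres_mulE mulr1. Qed.

Lemma pres_mulDl : left_distributive pres_mul +%R.
Proof.
move=> a b c; rewrite -(pres_classK a) -(pres_classK b) -(pres_classK c).
by rewrite -raddfD !pres_mulE mulrDl raddfD.
Qed.

Lemma pres_mulDr : right_distributive pres_mul +%R.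
Proof.
move=> a b c; rewrite -(pres_classK a) -(pres_classK b) -(pres_classK c).
by rewrite -raddfD !pres_mulE mulrDr raddfD.
Qed.

HB.instance Definition _ :=
  GRing.Zmodule_isPzRing.Build A pres_mulA pres_mul1r pres_mulr1
    pres_mulDl pres_mulDr.

Lemma pres_scaleA (c d : K) a :
  pres_scale c (pres_scale d a) = pres_scale (c * d) a.
Proof. by rewrite -(pres_classK a) !pres_scaleE scalerA. Qed.

Lemma pres_scale1 : left_id 1 pres_scale.
Proof. by move=> a; rewrite -(pres_classK a) pres_scaleE scale1r. Qed.

Lemma pres_scaleDr : right_distributive pres_scale +%R.
Proof.
move=> c a b; rewrite -(pres_classK a) -(pres_classK b).
by rewrite -raddfD !pres_scaleE scalerDr raddfD.
Qed.

Lemma pres_scaleDl a : {morph pres_scale^~ a : c d / c + d}.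
Proof.
by move=> c d; rewrite -(pres_classK a) !pres_scaleE scalerDl raddfD.
Qed.

HB.instance Definition _ :=
  GRing.Zmodule_isLmodule.Build K A pres_scaleA pres_scale1
    pres_scaleDr pres_scaleDl.

Lemma pres_class_is_monoid_morphism : monoid_morphism pres_class.
Proof. by split=> // f g; rewrite -pres_mulE. Qed.

HB.instance Definition _ :=
  GRing.isMonoidMorphism.Build (freeAlg K X) A pres_class
    pres_class_is_monoid_morphism.

Lemma pres_class_is_scalable : scalable pres_class.
Proof. by move=> c f; rewrite -pres_scaleE. Qed.

HB.instance Definition _ :=
  GRing.isScalable.Build K (freeAlg K X) A _ pres_class pres_class_is_scalable.

End PresAlg.

Record augmentation (K : fieldType) (X : choiceType) (R : set (freeAlg K X))
    (eps : {rmorphism presAlg R -> K}) : Prop := Augmentation {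
  aug_scale : scalable_for *%R eps;
  aug_surj : forall c : K, exists a : presAlg R, eps a = c
}.

Record monomial_order (X : choiceType) (lt : word X -> word X -> Prop) : Prop :=
  MonomialOrder {
  mo_irrefl : forall u, ~ lt u u;
  mo_trans : forall u v w, lt u v -> lt v w -> lt u w;
  mo_total : forall u v, [\/ lt u v, u = v | lt v u];
  mo_wf : well_founded lt;
  mo_compat : forall u v w w', lt u v -> lt (w ++ u ++ w') (w ++ v ++ w')
}.

Definition word_class (K : fieldType) (X : choiceType) (R : set (freeAlg K X))
  (w : word X) : presAlg R := pres_class R << FMonom w >>.

Definition normal_words (K : fieldType) (X : choiceType)
    (R : set (freeAlg K X)) (lt : word X -> word X -> Prop) : set (word X) :=
  [set w | forall (n : nat) (u : 'I_n -> word X) (c : 'I_n -> K),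
     (forall i, lt (u i) w) ->
     word_class R w <> \sum_(i < n) c i *: word_class R (u i)].

(* [infix u w]: u is a (contiguous) subword of w. *)
Definition obstructions (X : choiceType) (M : set (word X)) : set (word X) :=
  [set y | ~ M y /\ forall u, infix u y -> u != y -> M u].

(* x_a x_{a+1} ... x_b, where w = x_1 x_2 ... (positions are 1-based). *)
Definition factor (X : choiceType) (w : word X) (a b : nat) : word X :=
  take (b.+1 - a) (drop a.-1 w).

(* The n-tuples (a_1, ..., a_n) and (b_1, ..., b_n) are the values at 1, ..., n
   of a, b : nat -> nat; the other values are never used.  The chain
   1 = a_1 < a_2 <= b_1 < a_3 <= b_2 < ... < a_n <= b_{n-1} < b_n = l
   is cut into its successive links. *)
Record prechain_at (X : choiceType) (V : set (word X)) (n : nat) (w : word X)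
    (a b : nat -> nat) : Prop := PrechainAt {
  pc_first : a 1%N = 1%N;
  pc_a12 : (2 <= n)%N -> (a 1%N < a 2%N)%N;
  pc_ab : forall i : nat, (1 <= i)%N -> (i.+1 <= n)%N -> (a i.+1 <= b i)%N;
  pc_ba : forall i : nat, (1 <= i)%N -> (i.+2 <= n)%N -> (b i < a i.+2)%N;
  pc_blast : (2 <= n)%N -> (b n.-1 < b n)%N;
  pc_last : b n = size w;
  pc_obs : forall i : nat, (1 <= i <= n)%N -> V (factor w (a i) (b i))
}.

Definition prechain (X : choiceType) (V : set (word X)) (n : nat) (w : word X) :
  Prop := exists a b : nat -> nat, prechain_at V n w a b.

Definition topdown_chain (X : choiceType) (V : set (word X)) (n : nat)
    (w : word X) : Prop :=
  exists a b : nat -> nat, prechain_at V n w a b /\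
    forall m i : nat, (1 <= m <= n)%N -> (1 <= i)%N -> (i <= b m - 1)%N ->
      ~ prechain V m (take i w).

(* Indexed by int; only the indices n >= -1 are meaningful. *)
Definition topdown (X : choiceType) (V : set (word X)) (n : int) :
    set (word X) :=
  match n with
  | Posz 0 => [set w | exists x : X, w = [:: x]]
  | Posz n => [set w | topdown_chain V n w]
  | Negz 0 => [set [::]]
  | Negz _ => set0
  end.

Definition Q_nodes (X : choiceType) (V : set (word X)) : set (word X) :=
  [set s | [\/ s = [::], exists x : X, s = [:: x] |
            exists2 y, V y & suffix s y /\ s != y]].

(* An occurrence in w of an element of V is a decomposition w = a ++ v ++ b. *)
Definition occurrence (X : choiceType) (V : set (word X)) (w : word X)
    (o : word X * word X * word X) : Prop :=
  V o.1.2 /\ w = o.1.1 ++ o.1.2 ++ o.2.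

Definition one_occurrence_suffix (X : choiceType) (V : set (word X))
    (w : word X) : Prop :=
  exists o, [/\ occurrence V w o, forall o', occurrence V w o' -> o' = o &
                o.2 = [::]].

Definition Q_edge (X : choiceType) (V : set (word X)) (s t : word X) : Prop :=
  (s = [::] /\ exists x : X, t = [:: x]) \/
  [/\ Q_nodes V s, Q_nodes V t, s <> [::], t <> [::] &
      one_occurrence_suffix V (s ++ t)].

(* [ws] lists the nodes w_1, ..., w_n that follow w_0 = 1 on the path. *)
Definition bottomup (X : choiceType) (V : set (word X)) (n : nat) :
    set (word X) :=
  [set w | exists ws : seq (word X),
     [/\ size ws = n, path (fun s t => `[< Q_edge V s t >]) [::] ws &
         w = flatten ([::] :: ws)]].

(* Main.v *)
Require Import Defs.
From mathcomp Require Import all_boot all_order all_algebra.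
From mathcomp Require Import boolp classical_sets.
From mathcomp.multinomials Require Import monalg.
From mathcomp Require Import zify.

(** Both kinds of chains are described by the same sequence of cut positions.

    For a chain [w] with top-down data [(a_i)], [(b_i)], put [e_0 = 0],
    [e_1 = 1] and [e_(m+1) = b_m].  The words [x_(e_m + 1) ... x_(e_(m+1))]
    are the nodes of a path in Q: the obstruction ending at [b_m] starts
    strictly after [e_(m-1)] and not after [e_m], so it is a suffix of the
    product of two consecutive pieces, and the second piece is a proper suffix
    of it.  That no other obstruction occurs in this product is exactly what
    minimality of [b_m] means: an obstruction occurring there and ending
    earlier cannot lie inside one piece, since each piece is a letter or a
    proper suffix of an obstruction, so it straddles the cut [e_m] and makes
    a strictly shorter prefix of [w] an [m]-prechain.  Conversely, if the
    product of any two consecutive pieces contains a single obstruction, as a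
    suffix, then by induction on [m] every [m]-prechain that is a prefix of [w] has length
    at least [e_(m+1)]: its last obstruction starts after [e_(m-1)], by the
    case [m - 2], and so it cannot end before [e_(m+1)].

    The condition on two consecutive pieces is [linked]; [bottomupP]
    expresses bottom-up chains through it, [topdown_cutting] and
    [cutting_topdown] top-down chains.  All that is used of the set of obstructions is that none is a proper subword of another
    ([obstructions_antichain]), which holds by their definition, and that all
    have length at least 2 ([obstructions_size]), where the augmentation, the
    order and the normality of letters intervene. *)

Set Implicit Arguments.
Unset Strict Implicit.
Unset Printing Implicit Defensive.

Import GRing.Theory.

(** * Factors of a word *)

Section Factors.
Variable X : choiceType.
Implicit Types (u v w : seq X) (p q r c d i : nat).

Lemma size_factor w c d :
  0 < c -> d <= size w -> size (factor w c d) = d.+1 - c.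
Proof. by move=> c0 dw; rewrite /factor size_take size_drop; case: ifP; lia. Qed.

Lemma factor_full w : factor w 1 (size w) = w.
Proof. by rewrite /factor subn1 /= drop0 take_size. Qed.

Lemma factor_nil w p : factor w p.+1 p = [::].
Proof. by rewrite /factor subnn take0. Qed.

Lemma factor_cat w p q r :
  p <= q -> q <= r -> factor w p.+1 q ++ factor w q.+1 r = factor w p.+1 r.
Proof.
move=> pq qr; rewrite /factor !subSS /=.
have -> : r - p = (q - p) + (r - q) by lia.
by rewrite takeD drop_drop subnK.
Qed.

Lemma factor_factor w p r c d : 0 < c -> c <= d -> p + d <= r ->
  factor (factor w p.+1 r) c d = factor w (p + c) (p + d).
Proof.
case: c => // c _ cd pdr; rewrite /factor addnS !subSS /=.
rewrite take_drop take_takel; last lia.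
rewrite -take_drop drop_drop.
by congr (take _ (drop _ w)); lia.
Qed.

Lemma factor_take w i c d :
  0 < c -> factor (take i w) c d = factor w c (minn d i).
Proof.
case: c => // c _; rewrite /factor !subSS /=.
have [ci|ic] := leqP c i; last first.
  rewrite drop_oversize; last by rewrite size_take; case: ifP; lia.
  by rewrite (_ : minn d i - c = 0) ?take0 //; lia.
by rewrite subn_minl take_min [take (i - c) _]take_drop subnK.
Qed.

Lemma factor_mid u v w :
  factor (u ++ v ++ w) (size u).+1 (size u + size v) = v.
Proof.
by rewrite /factor subSS addKn /= drop_size_cat // take_size_cat.
Qed.

Lemma suffix_factor w c c' d :
  0 < c -> c <= c' -> suffix (factor w c' d) (factor w c d).
Proof.
move=> c0 cc'; case: c c' c0 cc' => // c [|c'] // _ cc'.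
have [c'd|dc'] := leqP c' d.
  by rewrite -(@factor_cat w c c' d) ?suffix_suffix.
by rewrite {1}/factor (_ : d.+1 - _ = 0) ?take0 ?suffix0s //; lia.
Qed.

Lemma prefix_factor w c d d' :
  d' <= d -> prefix (factor w c d') (factor w c d).
Proof.
move=> dd'; rewrite /factor.
by rewrite -(@take_takel _ (d'.+1 - c) (d.+1 - c)) ?prefix_take //; lia.
Qed.

Lemma infix_factor w c d c' d' : 0 < c -> c <= c' -> d' <= d ->
  infix (factor w c' d') (factor w c d).
Proof.
move=> c0 cc' dd'; apply: (@infix_trans _ (factor w c' d)).
  exact/prefixW/prefix_factor.
exact/suffixW/suffix_factor.
Qed.

End Factors.

(** * Cut positions and linked pieces *)

Section Chains.
Variables (X : choiceType) (V : set (seq X)).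
Hypothesis V_antichain : forall u v, V u -> V v -> infix u v -> u = v.
Hypothesis V_size : forall v, V v -> 1 < size v.
Implicit Types (w : seq X) (p q r c d m n : nat) (e : nat -> nat).

(** The condition for an edge of Q, read on positions: [p < q < r] cut out of
    [w] two consecutive pieces, and the only obstruction in their product is a
    suffix of it, which starts in the first piece. *)
Definition linked w p q r := exists c,
  [/\ p < c <= q, q < r, V (factor w c r) &
      forall c' d', p < c' -> d' < r -> ~ V (factor w c' d')].

(** The pieces of [w] are numbered from 0 to [n], hence the [n] conditions
    on consecutive pieces; [e 1 = 1] because a path in Q starts with a letter. *)
Definition cutting n w e :=
  [/\ e 0 = 0, e 1 = 1, e n.+1 = size w &
      forall m, m < n -> linked w (e m) (e m.+1) (e m.+2)].

Lemma factor_V_lt w c d : 0 < c -> V (factor w c d) -> c < d.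
Proof.
move=> c0 /V_size; rewrite /factor size_take size_drop.
by case: ifP; lia.
Qed.

Lemma factor_antichain w c d c' d' : 0 < c -> c <= c' -> d' <= d ->
  d <= size w -> V (factor w c d) -> V (factor w c' d') -> c = c' /\ d = d'.
Proof.
move=> c0 cc' d'd dw Vcd Vcd'.
have E := V_antichain Vcd' Vcd (infix_factor w c0 cc' d'd).
have := congr1 size E; rewrite !size_factor; [|lia..].
have := factor_V_lt c0 Vcd; have := factor_V_lt (leq_trans c0 cc') Vcd'.
lia.
Qed.

(** The occurrence at the end is the only one as soon as none ends earlier:
    of two obstructions ending at the same place, one is a suffix of the
    other. *)
Lemma one_occurrence_suffixP w p r : p <= r -> r <= size w ->
  one_occurrence_suffix V (factor w p.+1 r) <->
  exists c, [/\ p < c, c <= r, V (factor w c r) &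
    forall c' d', p < c' -> d' < r -> ~ V (factor w c' d')].
Proof.
move=> pr rw.
(* a subword at positions [c .. d] gives the occurrence cut out there *)
have occE c d : p < c -> c <= d -> d <= r -> V (factor w c d) ->
    occurrence V (factor w p.+1 r)
      (factor w p.+1 c.-1, factor w c d, factor w d.+1 r).
  case: c => // c pc cd dr Vcd; split=> //=.
  by rewrite !factor_cat //; lia.
(* and every occurrence is of this form *)
have posE o : occurrence V (factor w p.+1 r) o ->
    let c := p + (size o.1.1).+1 in let d := p + size o.1.1 + size o.1.2 in
    [/\ p < c, d <= r, r - d = size o.2 & o.1.2 = factor w c d].
  case: o => -[o1 v] o2 [/= Vv E]; have vs := V_size Vv.
  have sE := congr1 size E; rewrite size_factor // !size_cat in sE.
  split; [lia|lia|lia|].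
  by rewrite -addnA -(@factor_factor _ w p r) ?E ?factor_mid //; lia.
split=> [[o [occ uniq o2]]|[c [pc cr Vc min]]].
  have [pc dr rd vE] := posE _ occ; rewrite o2 /= in rd.
  have dE : p + size o.1.1 + size o.1.2 = r by lia.
  rewrite dE in vE; have Vo := occ.1; have Vo' := V_size Vo.
  exists (p + (size o.1.1).+1); split=> //; [lia|by rewrite -vE|].
  move=> c' d' pc' d'r Vc'.
  have c'd' := factor_V_lt (leq_ltn_trans (leq0n p) pc') Vc'.
  have := occE _ _ pc' (ltnW c'd') (ltnW d'r) Vc'.
  move/uniq/(congr1 (size \o snd)) => /=.
  by rewrite o2 size_factor //=; lia.
exists (factor w p.+1 c.-1, factor w c r, factor w r.+1 r); split=> /=.
- exact: occE.
- move=> [[o1 v] o2] occ; have [/= pc' d'r rd vE] := posE _ occ.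
  have Vv : V v := occ.1; rewrite vE in Vv.
  move: pc' d'r rd vE Vv; set c' := p + _.+1; set d' := _ + size v.
  move=> pc' d'r rd vE Vv.
  have d'E : d' = r.
    by apply/eqP; rewrite eqn_leq d'r leqNgt; apply/negP => /(min _ _ pc').
  have cE : c = c'.
    rewrite d'E in Vv; have [cc'|/ltnW c'c] := leqP c c'.
      by case: (factor_antichain _ cc' (leqnn r) rw Vc Vv) => //; lia.
    by case: (factor_antichain _ c'c (leqnn r) rw Vv Vc) => //; lia.
  have [_ /= E] := occ.
  have o2E : o2 = [::] by apply/nilP; rewrite /nilp; lia.
  have o1E : o1 = factor w p.+1 c.-1.
    have : prefix o1 (factor w p.+1 r) by rewrite E prefix_prefix.
    rewrite prefixE => /eqP <-.
    rewrite /factor !subSS /= take_takel.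
      by congr (take _ _); rewrite cE /c'; lia.
    by move: E => /(congr1 size); rewrite size_factor // !size_cat; lia.
  by rewrite o1E o2E vE d'E -cE factor_nil.
- exact: factor_nil.
Qed.

(** A node of Q contains no obstruction, since obstructions are pairwise
    incomparable and longer than letters. *)
Lemma node_free s v : Q_nodes V s -> V v -> ~~ infix v s.
Proof.
move=> [->|[x ->]|[y Vy [sy /eqP ny]]] Vv; apply/negP => iv.
- by have := size_infix iv; have := V_size Vv; case: v {Vv iv}.
- by have := size_infix iv; have := V_size Vv => /=; lia.
- have vy := V_antichain Vv Vy (infix_trans iv (suffixW sy)).
  have sz : size s = size y.
    by apply/eqP; rewrite eqn_leq size_suffix //= -{1}vy size_infix.
  by apply: ny; move: sy; rewrite suffixE sz subnn drop0 => /eqP.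
Qed.

Lemma Q_edge_neq0 s t : Q_edge V s t -> t <> [::].
Proof. by case=> [[_ [x ->]]|[]]. Qed.

(** The second piece is a node because the obstruction starts in the first. *)
Lemma linked_node w p q r : r <= size w -> linked w p q r ->
  Q_nodes V (factor w q.+1 r).
Proof.
move=> rw [c [pcq qr Vc _]]; apply: Or33; exists (factor w c r) => //.
split; first by apply: suffix_factor; lia.
by apply/eqP => /(congr1 size); rewrite !size_factor //; lia.
Qed.

Lemma linked_edge w p q r : p < q -> r <= size w ->
  Q_nodes V (factor w p.+1 q) -> linked w p q r ->
  Q_edge V (factor w p.+1 q) (factor w q.+1 r).
Proof.
move=> pq rw Np L; right; have [c [pcq qr Vc min]] := L.
split=> //; first exact: linked_node L.
- by move/(congr1 size); rewrite size_factor //=; lia.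
- by move/(congr1 size); rewrite size_factor //=; lia.
rewrite factor_cat; [|lia..]; apply/one_occurrence_suffixP; [lia|lia|].
by exists c; split=> //; lia.
Qed.

(** The obstruction ending the product starts in the first piece because the
    second one, being a node, contains none. *)
Lemma edge_linked w p q r : p < q -> q <= r -> r <= size w ->
  Q_edge V (factor w p.+1 q) (factor w q.+1 r) -> linked w p q r.
Proof.
move=> pq qr rw [[/(congr1 size)]|[_ Nq _ tn]].
  by rewrite size_factor /=; lia.
rewrite factor_cat // ?(ltnW pq) //.
have {}qr : q < r.
  rewrite ltn_neqAle qr andbT; apply/eqP => qrE; apply: tn.
  by rewrite qrE factor_nil.
case/one_occurrence_suffixP; [lia|lia|] => c [pc cr Vc min].
exists c; split=> //; rewrite pc /= leqNgt; apply/negP => qc.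
by have /negP := node_free Nq Vc; apply; apply: infix_factor.
Qed.

Lemma cutting_lt n w e : cutting n w e -> forall m, m <= n -> e m < e m.+1.
Proof.
by case=> e0 e1 _ L [|m] mn; [rewrite e0 e1|have [c []] := L m mn].
Qed.

Lemma cutting_le n w e : cutting n w e -> forall m, m <= n.+1 -> e m <= size w.
Proof.
move=> C m mn; rewrite -(subKn mn); elim: (n.+1 - m) (leq_subr m n.+1).
  by have [_ _ <- _] := C; rewrite subn0.
move=> k IH kn; apply: leq_trans (IH (ltnW kn)).
have -> : n.+1 - k = (n.+1 - k.+1).+1 by lia.
by apply/ltnW/(cutting_lt C); lia.
Qed.

(** * Bottom-up chains *)

Lemma cutting_flatten n w e : cutting n w e ->
  flatten (mkseq (fun m => factor w (e m).+1 (e m.+1)) n.+1) = w.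
Proof.
move=> C; have [e0 _ eN _] := C.
suff H k : k <= n -> flatten (mkseq (fun m => factor w (e m).+1 (e m.+1)) k.+1)
    = factor w 1 (e k.+1) by rewrite H // eN factor_full.
elim: k => [|k IH] kn; first by rewrite /= e0 cats0.
rewrite mkseqS flatten_rcons IH ?(ltnW kn) // factor_cat //.
by apply/ltnW/(cutting_lt C).
Qed.

(** The cut positions of a path are the lengths of its partial products. *)
Lemma nth_flatten_factor (ws : seq (seq X)) m : m < size ws ->
  let e k := size (flatten (take k ws)) in
  e m.+1 = e m + size (nth [::] ws m) /\
  nth [::] ws m = factor (flatten ws) (e m).+1 (e m.+1).
Proof.
move=> mw e; have eS : e m.+1 = e m + size (nth [::] ws m).
  by rewrite /e (take_nth [::]) // flatten_rcons size_cat.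
split=> //; rewrite eS -{2}(cat_take_drop m ws) (drop_nth [::]) //.
by rewrite flatten_cat /= factor_mid.
Qed.

Lemma bottomupP n w : bottomup V n.+1 w <-> exists e, cutting n w e.
Proof.
split=> [[ws [wsN /(pathP [::]) wsP /= wE]]|[e C]].
  have edge m : m < n.+1 -> Q_edge V (nth [::] ([::] :: ws) m) (nth [::] ws m).
    by rewrite -wsN => mn; apply/asboolP/wsP.
  pose e k := size (flatten (take k ws)).
  have ews m : m < n.+1 -> e m.+1 = e m + size (nth [::] ws m) /\
      nth [::] ws m = factor w (e m).+1 (e m.+1).
    by rewrite -wsN wE => /nth_flatten_factor.
  have elt m : m < n.+1 -> e m < e m.+1.
    move=> mn; have [-> _] := ews m mn.
    have := Q_edge_neq0 (edge m mn); case: (nth _ _ _) => //= *; lia.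
  have ele k : e k <= size w.
    rewrite wE /e -{2}(cat_take_drop k ws) flatten_cat size_cat; exact: leq_addr.
  exists e; split.
  - by rewrite /e take0.
  - have [-> _] := ews 0 isT; rewrite {1}/e take0 /=.
    by case: (edge 0 isT) => [[_ [x ->]]|[_ _ /(_ erefl)]].
  - by rewrite /e -wsN take_size wE.
  - move=> m mn; apply: edge_linked; [exact/elt/ltnW|exact/ltnW/elt|exact: ele|].
    have [_ <-] := ews m (ltnW mn); have [_ <-] := ews m.+1 mn.
    exact: (edge m.+1).
have [e0 e1 eN L] := C.
exists (mkseq (fun m => factor w (e m).+1 (e m.+1)) n.+1).
split; [exact: size_mkseq| |
  by rewrite /= -[RHS]/(flatten (mkseq _ n.+1)) cutting_flatten].
have first_letter : exists x, factor w (e 0).+1 (e 1) = [:: x].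
  have : size (factor w (e 0).+1 (e 1)) = 1.
    by rewrite size_factor ?(cutting_le C) // e0 e1.
  by case: (factor _ _ _) => [|x [|]] // _; exists x.
have node m : m <= n -> Q_nodes V (factor w (e m).+1 (e m.+1)).
  case: m => [_|m mn]; first by apply: Or32.
  by apply: linked_node (L m mn); apply: (cutting_le C).
apply/(pathP [::]) => m; rewrite size_mkseq => mn; apply/asboolP.
case: m mn => [_|m mn]; first by left.
set ws := mkseq _ _; rewrite -[nth _ (_ :: _) _]/(nth [::] ws m).
rewrite !nth_mkseq ?(ltnW mn) //; apply: linked_edge (L m mn).
- exact/(cutting_lt C)/ltnW.
- exact: (cutting_le C).
- exact/node/ltnW.
Qed.

(** * Top-down chains *)

(** [b i < a i.+2 <= b i.+1], except at the last link, where the definition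
    provides the inequality. *)
Lemma prechain_at_lt n w a b : prechain_at V n w a b ->
  forall i, 1 <= i -> i < n -> b i < b i.+1.
Proof.
move=> P i i1 iN; have [iN2|iN2] := leqP i.+2 n.
  exact: leq_trans (pc_ba P i1 iN2) (pc_ab P (ltn0Sn i) iN2).
have nE : n = i.+1 by lia.
by have := pc_blast P; rewrite nE; apply.
Qed.

Lemma prechain_at_le n w a b : prechain_at V n w a b ->
  forall i j, 1 <= i -> i <= j -> j <= n -> b i <= b j.
Proof.
move=> P i j i1; elim: j => [|j IH]; first by case: i i1.
rewrite leq_eqVlt => /predU1P[-> //|]; rewrite ltnS => ij jn.
apply: leq_trans (IH ij (ltnW jn)) _.
by apply/ltnW/(prechain_at_lt P) => //; apply: leq_trans ij.
Qed.

(** The cut positions of a top-down chain with right ends [b]: these start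
    with 0 and 1, so that the obstruction of rank [m] ends at the cut [m.+1]. *)
Definition cuts (b : nat -> nat) k := if k is k'.+2 then b k'.+1 else k.

Lemma cuts_lt_a n w a b : prechain_at V n w a b ->
  forall m, m < n -> cuts b m < a m.+1 <= cuts b m.+1.
Proof.
move=> P [|[|m]] mn /=; first by rewrite (pc_first P).
  by rewrite -[X in X < _](pc_first P) (pc_a12 P) ?(pc_ab P).
by rewrite (pc_ba P) ?(pc_ab P).
Qed.

(** How minimality of a chain gets contradicted: this appends an obstruction
    at positions [c .. d] to the first [m.+1] obstructions of a longer
    prechain. *)
Lemma prechain_snoc n w a b m c d : prechain_at V n w a b ->
  m.+1 < n -> cuts b m.+1 < c <= cuts b m.+2 -> b m.+1 < d ->
  d <= size w -> V (factor w c d) -> prechain V m.+2 (take d w).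
Proof.
move=> P mn /andP[mc cb] bd dw Vcd.
exists (fun i => if i == m.+2 then c else a i).
exists (fun i => if i == m.+2 then d else b i).
have neq i : i <= m.+1 -> (i == m.+2) = false by move=> ?; apply/eqP; lia.
split.
- by rewrite neq // (pc_first P).
- move=> _; rewrite neq // (pc_first P); case: eqP => [[m0]|_].
    by move: mc; rewrite -m0.
  by rewrite -[X in X < _](pc_first P) (pc_a12 P) //; lia.
- move=> i i1 im; rewrite [i == _]neq //; case: eqP => [[->]|_] //.
  by apply: (pc_ab P) => //; lia.
- move=> i i1 im; rewrite [i == _]neq; last lia.
  case: eqP => [[iE]|ni]; first by move: i1 mc; rewrite -iE; case: (i).
  by apply: (pc_ba P) => //; lia.
- by move=> _; rewrite eqxx neq.
- by rewrite eqxx size_take; case: ltnP => //; lia.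
move=> i /andP[i1 im]; case: eqP => [_|ni].
  by rewrite factor_take ?minnn //; apply: leq_ltn_trans mc.
have in1 : i <= m.+1 by lia.
rewrite factor_take; last first.
  have /cuts_lt_a/(_ i.-1) := P.
  by rewrite prednK // => /(_ (leq_trans in1 (ltnW mn)))/andP[/(leq_ltn_trans _)->].
have -> : minn (b i) d = b i.
  by apply/minn_idPl/(leq_trans (prechain_at_le P i1 in1 (ltnW mn)))/ltnW.
by apply: (pc_obs P); rewrite i1; lia.
Qed.

(** A piece of a top-down chain is a letter or a proper suffix of an
    obstruction, so it is too short to contain an obstruction or would make
    two of them comparable. *)
Lemma piece_free n w a b m c d : prechain_at V n w a b -> m <= n ->
  cuts b m < c -> d <= cuts b m.+1 -> ~ V (factor w c d).
Proof.
move=> P mn mc dm Vcd; have c0 : 0 < c by apply: leq_ltn_trans mc.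
case: m => [|m] in mn mc dm *.
  by have := factor_V_lt c0 Vcd; move: dm mc => /=; lia.
have /andP[am ma] := cuts_lt_a P mn.
have bw : b m.+1 <= size w by rewrite -(pc_last P) (prechain_at_le P).
have a0 : 0 < a m.+1 by apply: leq_ltn_trans am.
have [|ac _] := factor_antichain a0 (ltnW (leq_ltn_trans ma mc)) dm bw _ Vcd.
  by apply: (pc_obs P).
by move: mc; rewrite -ac; lia.
Qed.

Lemma topdown_cutting n w : topdown_chain V n.+1 w ->
  exists e, cutting n.+1 w e.
Proof.
move=> [a [b [P minb]]]; exists (cuts b); split=> //; first exact: pc_last P.
move=> m mn; exists (a m.+1); have amc := cuts_lt_a P mn.
have bw : b m.+1 <= size w by rewrite -(pc_last P) (prechain_at_le P).
have Vab : V (factor w (a m.+1) (b m.+1)) by apply: (pc_obs P).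
split=> //.
  case: m mn amc bw Vab => [|m] mn amc bw Vab; last exact: (prechain_at_lt P).
  by have := factor_V_lt _ Vab; rewrite (pc_first P); apply.
move=> c d mc db Vcd; have c0 : 0 < c by apply: leq_ltn_trans mc.
have cd := factor_V_lt c0 Vcd; rewrite /= in db.
(* the obstruction has to straddle the cut between the two pieces *)
have cm : c <= cuts b m.+1.
  by rewrite leqNgt; apply/negP => mc'; apply: (piece_free P mn mc' (ltnW db)).
have md : cuts b m.+1 < d.
  rewrite ltnNge; apply/negP => dm.
  exact: (piece_free P (ltnW mn) mc dm).
case: m => [|m] in mn amc bw Vab mc db cm md *; last first.
  apply: (minb m.+2 d); [by []|lia|lia|].
  by apply: (prechain_snoc P mn _ md _ Vcd); rewrite ?mc //; lia.
(* the first obstruction starts with the first letter and has no proper prefix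
   that is an obstruction *)
have a1 : a 1 = 1 := pc_first P; rewrite a1 in Vab.
by have [] := factor_antichain (ltn0Sn 0) c0 (ltnW db) bw Vab Vcd; lia.
Qed.

(** A two-step induction: the obstruction of rank [j.+1] starts after the end
    of the one of rank [j.-1], which is at least [e j] by induction (and after
    [e j], which is 0 or 1, when there is no such rank), so [linked] forbids
    it to end before [e j.+2].  The [minn] comes from [factor], which truncates
    at the end of [take i w]. *)
Lemma cutting_min n w e m i a b : cutting n w e -> m <= n ->
  prechain_at V m (take i w) a b ->
  forall j, j < m -> e j.+2 <= minn (b j.+1) i.
Proof.
move=> C mn P; have [e0 e1 eN L] := C.
elim/ltn_ind=> j IH jm; rewrite leqNgt; apply/negP => bj.
have [c [_ _ _ min]] := L j (leq_trans jm mn).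
have /andP[ca _] := cuts_lt_a P jm.
have ea : e j < a j.+1.
  apply: leq_ltn_trans ca; case: j IH jm {bj c min} => [|[|j]] IH jm /=.
  - by rewrite e0.
  - by rewrite e1.
  - by have := IH j (ltnW (ltnSn _)) (ltnW (ltnW jm)); lia.
apply: (min _ _ ea bj); rewrite -factor_take ?(leq_ltn_trans _ ea) //.
exact: (pc_obs P).
Qed.

Lemma cutting_topdown n w e : cutting n.+1 w e -> topdown_chain V n.+1 w.
Proof.
move=> C; have [e0 e1 eN L] := C.
have /choice[f fP] : forall m, exists c, m < n.+1 ->
    [/\ e m < c <= e m.+1, e m.+1 < e m.+2, V (factor w c (e m.+2)) &
      forall c' d', e m < c' -> d' < e m.+2 -> ~ V (factor w c' d')].
  move=> m; have [mn|nm] := ltnP m n.+1; last by exists 0.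
  by have [c ?] := L m mn; exists c.
exists (fun i => f i.-1), (fun i => e i.+1); split.
  split=> //=.
  - by have [] := fP 0 isT; rewrite e0 e1; lia.
  - move=> n2; have [] := fP 0 isT; have [] := fP 1 n2; rewrite e0 e1; lia.
  - by move=> i i1 iN; have [/andP[]] := fP i iN.
  - by move=> [|i] // _ iN; have [/andP[]] := fP i.+2 iN.
  - by move=> n2; apply: (cutting_lt C).
  - by move=> [|i] //= iN; have [] := fP i iN.
move=> [|m] i //= mn i1 im [a [b P]].
by have := cutting_min C mn P (ltnSn m); lia.
Qed.

End Chains.

(** * Obstructions *)

Section Obstructions.
Local Open Scope ring_scope.
Variable X : choiceType.

Lemma obstructions_antichain (M : set (seq X)) u v :
  obstructions M u -> obstructions M v -> infix u v -> u = v.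
Proof.
move=> [nMu _] [_ Mv] uv; apply/eqP/negPn/negP => nuv.
exact/nMu/Mv.
Qed.

(** [u v < v] would start an infinite descent [v > u v > u u v > ...]. *)
Lemma monomial_order_catl (lt : seq X -> seq X -> Prop) :
  monomial_order lt -> forall u v, ~ lt (u ++ v) v.
Proof.
move=> mo u v; elim: v / (mo_wf mo v) => v _ IH uv.
apply: (IH _ uv); have := mo_compat mo u [::] uv.
by rewrite !cats0.
Qed.

Variables (K : fieldType) (R : set {malg K[{fmonom X}]}).
Variables (lt : seq X -> seq X -> Prop) (lt_mo : monomial_order lt).
Variable eps : {rmorphism presAlg R -> K}.

(** No word precedes the empty one, so the empty word can fail to be normal
    only if [1 = 0] in the quotient, which the augmentation excludes. *)
Lemma empty_word_normal : normal_words R lt [::].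
Proof.
move=> [|n] u c ltu.
  rewrite big_ord0 => /(congr1 eps); rewrite rmorph0.
  have -> : word_class R [::] = 1.
    by rewrite /word_class -fmoneE -(rmorph1 (pres_class R)).
  by rewrite rmorph1 => /eqP; rewrite oner_eq0.
have := ltu ord0; rewrite -[u ord0]cats0.
by move/(monomial_order_catl lt_mo).
Qed.

Lemma obstructions_size (letters_normal : forall x, normal_words R lt [:: x]) v :
  obstructions (normal_words R lt) v -> (1 < size v)%N.
Proof.
case: v => [|x [|y v]] // [nM _]; case: nM; first exact: empty_word_normal.
exact: letters_normal.
Qed.

End Obstructions.

(* [letters_normal], i.e. X is contained in M, is necessary: when a letter x is
   an obstruction, x is a 1-chain in the top-down sense, but it is not in C_2,
   whose elements have length at least 2. *)
Theorem mainTheorem3 (K : fieldType) (X : choiceType) (X_nonempty : inhabited X)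
  (R : set {malg K[{fmonom X}]})
  (eps : {rmorphism presAlg R -> K}) (eps_aug : augmentation eps)
  (lt : seq X -> seq X -> Prop) (lt_mo : monomial_order lt)
  (letters_normal : forall x : X, normal_words R lt [:: x]) :
  forall n : nat,
    topdown (obstructions (normal_words R lt)) (n%:Z - 1)%R =
    bottomup (obstructions (normal_words R lt)) n.
Proof.
set V := obstructions _.
have Va : forall u v, V u -> V v -> infix u v -> u = v.
  by move=> u v; apply: obstructions_antichain.
have Vs : forall v, V v -> 1 < size v.
  by move=> v; apply: (obstructions_size lt_mo eps).
move=> [|n]; apply/predeqP => w.
  rewrite sub0r /=; split=> [->|[ws [/size0nil -> _ ->]]] //.
  by exists [::].
have -> : (n.+1%:Z - 1 = n%:Z)%R by rewrite intS addrAC subrr add0r.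
rewrite (bottomupP Va Vs) //; case: n => [|n]; last first.
  by split=> [/(topdown_cutting Va Vs)//|[e] /(cutting_topdown)].
split=> [[x ->]|[e [_ e1 ew _]]]; first by exists id; split.
by move: ew; rewrite e1; case: w => [|x [|]] // _; exists x.
Qed.
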